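(* Let $G$ be an interaction network with source $s$ and sink $t$. If $G$ is a chain, then the greedy algorithm computes the maximum flow in $G$; that is, the greedy flow $f(G)$ from $s$ to $t$ equals the maximum flow of $G$ from $s$ to $t$.
   Context: An interaction network is a finite directed graph $G(V,E)$ in which every edge $e=(v,u)\in E$ carries a finite sequence $e_S=\{(t_1,q_1),(t_2,q_2),\dots\}$ of interactions from $v$ to $u$; an interaction $(t_i,q_i)$ has a timestamp $t_i$ and a (nonnegative) quantity $q_i$. The graph is connected, and has a single source vertex $s$ (with no incoming edges) and a single sink vertex $t$ (with no outgoing edges). Chain: a connected directed acyclic graph in which the source $s$ has just one outgoing edge, the sink $t$ has just one incoming edge, and every other vertex has only one incoming and only one outgoing edge (so all edges form a single path that connects all vertices). Buffers: each vertex $v$ has a buffer $B_v$. The buffer of $s$ is always $\infty$; all other buffers are initially $0$. There is no bound on how much a vertex can buffer, and buffered quantities do not expire. All interactions of the network are processed in order of time. When an interaction on edge $(v,u)$ transfers a quantity $q$, $B_v$ is decreased by $q$ (it remains $\infty$ if $v=s$) and $B_u$ is increased by $q$. Greedy algorithm and greedy flow: every interaction $(t_i,q_i)$ on an edge $(v,u)$ transfers the maximum possible quantity $q=\min\{q_i,B_v\}$, where $B_v$ is the quantity buffered at $v$ at that moment. The greedy flow $f(G)$ is the value of $B_t$ after all interactions have been processed. Maximum flow: every interaction $(t_i,q_i)$ on an edge $(v,u)$ may transfer any quantity in $[0,\min\{q_i,B_v\}]$, where $B_v$ is the quantity buffered at $v$ at that moment, the rest being reserved at $v$ for future outgoing interactions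 of $v$. The maximum flow of $G$ is the largest value of $B_t$, after all interactions have been processed, over all such choices of transferred quantities. *)

(* Defs.v *)
From HB Require Import structures.
From mathcomp Require Import all_boot all_order all_algebra.
From mathcomp Require Import all_classical all_reals.

Set Implicit Arguments.
Unset Strict Implicit.
Unset Printing Implicit Defensive.
Import Order.TTheory GRing.Theory Num.Theory.
Local Open Scope classical_set_scope.
Local Open Scope ring_scope.
Local Open Scope ereal_scope.

Section Digraph.
Variables (V : finType) (E : {set V * V}).

Definition arc : rel V := fun v u => (v, u) \in E.

Definition in_nbrs (v : V) : {set V} := [set u | (u, v) \in E]%SET.
Definition out_nbrs (v : V) : {set V} := [set u | (v, u) \in E]%SET.

(* Connectedness disregards the orientation of the edges. *)
Definition connected_digraph : Prop :=
  forall v u : V, connect (fun x y => arc x y || arc y x) v u.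

(* [cycle] allows repeated vertices, and [:: v] is a cycle iff (v, v) is an
   edge, so self-loops are excluded as well. *)
Definition acyclic_digraph : Prop :=
  forall c : seq V, cycle arc c -> c = [::].

End Digraph.

(* The pairs in [ixs e] are (timestamp, quantity); only the values of [ixs] on
   edges matter. *)
Record network (R : realType) (V : finType) := Network {
  edges : {set V * V};
  ixs : V * V -> seq (R * R);
  src : V;
  snk : V;
  ixs_ge0 : forall e i, e \in edges -> i \in ixs e -> (0 <= i.2)%R;
  network_connected : connected_digraph edges;
  src_uniq : forall v, #|in_nbrs edges v| = 0%N <-> v = src;
  snk_uniq : forall v, #|out_nbrs edges v| = 0%N <-> v = snk
}.

Section Flow.
Variables (R : realType) (V : finType).
Implicit Types G : network R V.

Definition is_chain G : Prop :=
  [/\ connected_digraph (edges G),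
      acyclic_digraph (edges G),
      #|out_nbrs (edges G) (src G)| = 1%N,
      #|in_nbrs (edges G) (snk G)| = 1%N &
      forall v, v != src G -> v != snk G ->
        #|in_nbrs (edges G) v| = 1%N /\ #|out_nbrs (edges G) v| = 1%N].

(* An interaction together with the edge that carries it: ((v, u), (t, q)). *)
Definition event : Type := ((V * V) * (R * R))%type.
Definition ev_from (x : event) : V := x.1.1.
Definition ev_to (x : event) : V := x.1.2.
Definition ev_time (x : event) : R := x.2.1.
Definition ev_qty (x : event) : R := x.2.2.

Definition events G : seq event :=
  [seq (e, i) | e <- enum (edges G), i <- ixs G e].

Definition time_le : rel event := fun x y => (ev_time x <= ev_time y)%R.

(* The order in which the interactions are processed; it is determined by the
   network up to the order of simultaneous interactions, which is free. *)
Definition processing_order G (xs : seq event) : Prop :=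
  perm_eq xs (events G) /\ sorted time_le xs.

Lemma processing_order_sort G : processing_order G (sort time_le (events G)).
Proof.
split; first by rewrite perm_sort.
by apply: sort_sorted => x y; exact: le_total.
Qed.

Definition buffers : Type := V -> \bar R.

Definition init_buffers G : buffers :=
  fun v => if v == src G then +oo else 0.

(* For finite q the buffer +oo of the source stays +oo, since +oo - q = +oo. *)
Definition transfer (B : buffers) (x : event) (q : \bar R) : buffers :=
  fun w => B w - (if w == ev_from x then q else 0)
               + (if w == ev_to x then q else 0).

Definition max_transfer (B : buffers) (x : event) : \bar R :=
  Order.min (ev_qty x)%:E (B (ev_from x)).

Definition greedy_step (B : buffers) (x : event) : buffers :=
  transfer B x (max_transfer B x).

Definition greedy_flow G (xs : seq event) : \bar R :=
  foldl greedy_step (init_buffers G) xs (snk G).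

(* [execution B xs B']: processing xs from the buffers B can end in B', for some
   choice of the transferred quantities (finite, being bounded by [ev_qty]). *)
Inductive execution : buffers -> seq event -> buffers -> Prop :=
| execution_nil B : execution B [::] B
| execution_cons B x xs q B' :
    0 <= q <= max_transfer B x ->
    execution (transfer B x q) xs B' ->
    execution B (x :: xs) B'.

Definition flow_values G (xs : seq event) : set (\bar R) :=
  [set B (snk G) | B in execution (init_buffers G) xs].

Definition is_max_flow G (xs : seq event) (F : \bar R) : Prop :=
  flow_values G xs F /\ ubound (flow_values G xs) F.

End Flow.

(* Main.v *)
(** Along a chain the buffer of an inner vertex is its total inflow so far minus
    the total inflow of its successor. By induction over the processed
    interactions, the greedy inflow of every vertex dominates its inflow in any
    other execution: on an edge (a, b), greedy either moves the whole quantity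
    of the interaction, or empties a, and then the inflow of b becomes that of
    a, which dominates the inflow of a, hence that of b, in the other
    execution. *)

Require Import Defs.
From mathcomp Require Import all_boot all_order all_algebra.
From mathcomp Require Import all_classical all_reals.
From mathcomp Require Import lra.

Set Implicit Arguments.
Unset Strict Implicit.
Unset Printing Implicit Defensive.
Import Order.TTheory GRing.Theory Num.Theory.
Local Open Scope ring_scope.
Local Open Scope ereal_scope.

Section Executions.
Variables (R : realType) (V : finType).
Implicit Types (B : buffers R V) (x : event R V) (xs : seq (event R V)).

Lemma max_transfer_ge0 B x :
  (0 <= ev_qty x)%R -> (forall v, 0 <= B v) -> 0 <= max_transfer B x.
Proof. by move=> x0 B0; rewrite le_min lee_fin x0 B0. Qed.

(** The real bound [ev_qty x] makes [q] finite, so that amounts can be compared as reals. *)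
Lemma transfer_amount_fin B x q :
  0 <= q <= max_transfer B x -> q \is a fin_num.
Proof.
case/andP=> q0; rewrite le_min => /andP[qx _].
by rewrite ge0_fin_numE// (le_lt_trans qx)// ltry.
Qed.

Lemma transfer_ge0 B x q : (forall v, 0 <= B v) ->
  0 <= q <= max_transfer B x -> forall v, 0 <= transfer B x q v.
Proof.
move=> B0 hq v; have qfin := transfer_amount_fin hq.
case/andP: hq => q0; rewrite le_min => /andP[_ qB].
rewrite /transfer adde_ge0//; last by case: ifP.
by case: eqP => [->|_]; rewrite ?sube0// sube_ge0// qfin.
Qed.

(** Needed for the greedy flow to be attained as a flow value. Nonnegative buffers are the invariant
    that keeps the maximal transfer admissible. *)
Lemma greedy_execution B xs : (forall v, 0 <= B v) ->
  (forall x, x \in xs -> (0 <= ev_qty x)%R) ->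
  execution B xs (foldl (@greedy_step R V) B xs).
Proof.
elim: xs B => [|x xs IH] B B0 xs0 /=; first exact: execution_nil.
have hq : 0 <= max_transfer B x <= max_transfer B x.
  by rewrite lexx max_transfer_ge0// xs0// mem_head.
apply: (execution_cons hq); apply: IH; first exact: (transfer_ge0 B0 hq).
by move=> y yxs; rewrite xs0// in_cons yxs orbT.
Qed.

End Executions.

Section Chain.
Variables (R : realType) (V : finType) (G : network R V).
Hypothesis hG : is_chain G.
Implicit Types (A : V -> R) (B : buffers R V) (x : event R V).

(** The degree conditions of a chain give in-degree 1 everywhere but at the source, which the edge
    into [u] excludes. *)
Lemma chain_in_nbrs v u : (v, u) \in edges G -> in_nbrs (edges G) u = [set v]%SET.
Proof.
move=> vu; have vin : v \in in_nbrs (edges G) u by rewrite inE.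
have [_ _ _ int inn] := hG.
suff /eqP/cards1P[w uw] : #|in_nbrs (edges G) u| = 1%N.
  by move: vin; rewrite uw inE => /eqP ->.
have [->//|ut] := eqVneq u (snk G).
have [/src_uniq us|us] := eqVneq u (src G).
  by move/eqP: us; rewrite cards_eq0 => /eqP us; rewrite us inE in vin.
by have [] := inn u us ut.
Qed.

Lemma chain_out_nbrs v u :
  (v, u) \in edges G -> out_nbrs (edges G) v = [set u]%SET.
Proof.
move=> vu; have uout : u \in out_nbrs (edges G) v by rewrite inE.
have [_ _ outs _ inn] := hG.
suff /eqP/cards1P[w vw] : #|out_nbrs (edges G) v| = 1%N.
  by move: uout; rewrite vw inE => /eqP ->.
have [->//|vs] := eqVneq v (src G).
have [/snk_uniq vt|vt] := eqVneq v (snk G).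
  by move/eqP: vt; rewrite cards_eq0 => /eqP vt; rewrite vt inE in uout.
by have [] := inn v vs vt.
Qed.

(* As in-degrees are at most 1, the quantity sent so far along the edge (v, u)
   is the inflow [A u]. *)
Definition inflow A B : Prop :=
  B (src G) = +oo /\ forall v, v != src G ->
    B v = (A v - \sum_(u in out_nbrs (edges G) v) A u)%:E.

Lemma inflow_init : inflow (fun=> 0%R) (init_buffers G).
Proof.
split=> [|v /negPf vs]; first by rewrite /init_buffers eqxx.
by rewrite /init_buffers vs big1// subr0.
Qed.

Lemma inflow_snk A B : inflow A B -> B (snk G) = (A (snk G))%:E.
Proof.
have /eqP out0 : #|out_nbrs (edges G) (snk G)| = 0%N by exact/snk_uniq.
rewrite cards_eq0 in out0; case=> _ ->.
  by rewrite (eqP out0) big_set0 subr0.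
(* The sink is not the source: their out-degrees are 0 and 1. *)
apply/eqP => ts; have [_ _ + _ _] := hG.
by rewrite -ts (eqP out0) cards0.
Qed.

Lemma inflow_transfer A B x (q : R) : x.1 \in edges G -> inflow A B ->
  inflow (fun v => A v + (if v == ev_to x then q else 0))%R (transfer B x q%:E).
Proof.
case: x => [[a b] i]; rewrite /transfer /ev_from /ev_to /= => ab [Bs Bv].
split=> [|v vs]; first by rewrite Bs; do 2 case: ifP.
rewrite Bv// big_split /= -big_mkcondr /=.
(* The outflow of [v] grows only if [b] is an out-neighbour of [v]; as [a] is the only in-neighbour
   of [b], this means [v = a]. *)
have -> : (\sum_(u in out_nbrs (edges G) v | u == b) q =
           if v == a then q else 0)%R.
  have vb : ((v, b) \in edges G) = (v == a).
    by have := chain_in_nbrs ab => /setP/(_ v); rewrite !inE.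
  case: eqP vb => [->|_] vb.
    rewrite (big_pred1 b)// => u /=; rewrite !inE andbC.
    by case: eqP => // ->; rewrite vb.
  by rewrite big_pred0// => u; rewrite inE andbC; case: eqP => // ->.
by do 2 case: ifP => _; rewrite -?EFinB -?EFinD /=; congr (_%:E); lra.
Qed.

Lemma inflow_greedy_step A A' B B' x q : x.1 \in edges G ->
  inflow A B -> inflow A' B' -> (forall v, A' v <= A v)%R ->
  (0 <= ev_qty x)%R -> (forall v, 0 <= B v) -> 0 <= q <= max_transfer B' x ->
  (A' (ev_to x) + fine q <= A (ev_to x) + fine (max_transfer B x))%R.
Proof.
move=> ab [Bs Bv] [Bs' Bv'] AA x0 B0 hq.
have qfin := transfer_amount_fin hq.
have mfin : max_transfer B x \is a fin_num.
  by apply: (@transfer_amount_fin _ _ B x); rewrite lexx max_transfer_ge0.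
case/andP: hq => _; rewrite le_min -(fineK qfin) => /andP[qx qB].
rewrite lee_fin in qx.
(* The infinite buffer of the source lets greedy move the whole quantity, which bounds [q]. *)
have [as_|as_] := eqVneq (ev_from x) (src G).
  rewrite /max_transfer as_ Bs minEge leye_eq /=.
  exact: lerD.
have out : out_nbrs (edges G) (ev_from x) = [set ev_to x]%SET.
  by apply: chain_out_nbrs; rewrite -surjective_pairing.
(* For the edge [(a, b)] the buffers at [a] are now [A a - A b] and [A' a - A' b]. If greedy empties
   [a], then [A' b + q <= A' a <= A a = A b + (A a - A b)]. *)
move: qB; rewrite /max_transfer Bv// Bv'// out !big_set1 lee_fin -EFin_min /=.
have := AA (ev_to x); have := AA (ev_from x).
by rewrite minElt; case: ifP => _; lra.
Qed.

(** The invariant compares inflows, not buffers: greedy may hold less at an inner vertex, having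
    forwarded more. At the sink the two notions agree. *)
Lemma execution_le_greedy A A' B B' F xs :
  (forall x, x \in xs -> x.1 \in edges G /\ (0 <= ev_qty x)%R) ->
  inflow A B -> inflow A' B' -> (forall v, A' v <= A v)%R ->
  (forall v, 0 <= B v) -> execution B' xs F ->
  F (snk G) <= foldl (@greedy_step R V) B xs (snk G).
Proof.
move=> hxs IB IB' AA B0 ex.
elim: ex A A' B hxs IB IB' AA B0 => {B' xs F} [B' | B' x xs q F hq _ IH].
  move=> A A' B _ IB IB' AA _ /=.
  by rewrite (inflow_snk IB) (inflow_snk IB') lee_fin.
move=> A A' B hxs IB IB' AA B0 /=.
have [xE x0] : x.1 \in edges G /\ (0 <= ev_qty x)%R by apply/hxs/mem_head.
have hm : 0 <= max_transfer B x <= max_transfer B x.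
  by rewrite lexx max_transfer_ge0.
have IBq := inflow_transfer (fine q) xE IB'.
have IBm := inflow_transfer (fine (max_transfer B x)) xE IB.
rewrite fineK ?(transfer_amount_fin hq)// in IBq.
rewrite fineK ?(transfer_amount_fin hm)// in IBm.
apply: (IH _ _ _ _ IBm IBq).
- by move=> y yxs; apply: hxs; rewrite in_cons yxs orbT.
- move=> v; case: eqP => [->|_]; last by rewrite !addr0.
  exact: (inflow_greedy_step xE IB IB').
- exact: (transfer_ge0 B0 hm).
Qed.

End Chain.

Theorem lemma1 (R : realType) (V : finType) (G : network R V)
    (xs : seq (event R V)) (hG : is_chain G) (hxs : processing_order G xs) :
  is_max_flow G xs (greedy_flow G xs).
Proof.
have hx x : x \in xs -> x.1 \in edges G /\ (0 <= ev_qty x)%R.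
  case: hxs => /perm_mem -> _ /allpairsPdep[e [i [eE ie ->]]].
  rewrite mem_enum in eE; split=> //; exact: (ixs_ge0 eE ie).
have B0 v : 0 <= init_buffers G v by rewrite /init_buffers; case: ifP => _; rewrite ?le0y.
split.
  exists (foldl (@greedy_step R V) (init_buffers G) xs) => //.
  by apply: greedy_execution => // x /hx[].
move=> _ [F ex <-].
(* Both runs start from the same buffers, with zero inflow everywhere. *)
have I0 := inflow_init G.
exact: (execution_le_greedy hG hx I0 I0 (fun=> lexx _) B0 ex).
Qed.
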